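(* Let $1\le k<n$, let $\mathsf{A}\in\mathbb{R}^{n\times n}$ be invertible and partitioned as $\mathsf{A}=[\,\mathsf{A}_1\ \ \mathsf{A}_2\,]$ with $\mathsf{A}_1\in\mathbb{R}^{n\times k}$, $\mathsf{A}_2\in\mathbb{R}^{n\times(n-k)}$. Let $\mathsf{P}^\perp:\mathbb{R}^n\to\mathcal{R}(\mathsf{A}_2)^\perp$ be the orthogonal projector onto the orthogonal complement of the range of $\mathsf{A}_2$, and let $b\in\mathbb{R}^n$. Set $\mathsf{A}_1'=\mathsf{P}^\perp\mathsf{A}_1$ and $b'=\mathsf{P}^\perp b$. If $\mathsf{A}x=b$ with $x=\begin{bmatrix} x_1 \\ x_2 \end{bmatrix}$, $x_1\in\mathbb{R}^k$, $x_2\in\mathbb{R}^{n-k}$, then $x_1$ can be uniquely recovered by solving the projected least squares problem $\mathsf{A}_1'z=b'$; that is, the least squares problem $\min_{z\in\mathbb{R}^k}\|\mathsf{A}_1'z-b'\|$ has a unique solution, and this solution is $z=x_1$.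
   Context: $\mathcal{R}(\cdot)$ denotes the range (column space) of a matrix, and $\|\cdot\|$ is the Euclidean norm. The projector $\mathsf{P}^\perp$ is regarded as an $n\times n$ matrix. *)

(* Defs.v *)
From mathcomp Require Import all_boot all_order all_algebra.
From mathcomp Require Import boolp classical_sets reals.

Set Implicit Arguments.
Unset Strict Implicit.
Unset Printing Implicit Defensive.

Import Order.TTheory GRing.Theory Num.Theory.

Local Open Scope classical_set_scope.
Local Open Scope ring_scope.

Definition cvdot (R : realType) (n : nat) (u v : 'cV[R]_n) : R :=
  \sum_(i < n) u i 0 * v i 0.

(* The matrix norm of MathComp-Analysis is the max norm, hence this one. *)
Definition cvnorm (R : realType) (n : nat) (v : 'cV[R]_n) : R :=
  Num.sqrt (cvdot v v).

(* Column space; MathComp's own [(_ <= _)%MS] theory is about row spaces. *)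
Definition colspace (R : realType) (n p : nat) (A : 'M[R]_(n, p)) :
    set 'cV[R]_n :=
  range (fun w : 'cV[R]_p => A *m w).

Definition orthocompl (R : realType) (n : nat) (S : set 'cV[R]_n) :
    set 'cV[R]_n :=
  [set v | forall u, S u -> cvdot u v = 0].

(* [P v] is the component of [v] in the decomposition of the whole space as
   the orthogonal sum of [S] and its orthogonal complement; when [S] is a
   subspace, exactly one matrix satisfies this. *)
Definition orthogonal_projector (R : realType) (n : nat)
    (S : set 'cV[R]_n) (P : 'M[R]_n) : Prop :=
  forall v : 'cV[R]_n, S (P *m v) /\ orthocompl S (v - P *m v).

Definition least_squares_solution (R : realType) (n p : nat)
    (A : 'M[R]_(n, p)) (b : 'cV[R]_n) (z : 'cV[R]_p) : Prop :=
  forall y : 'cV[R]_p, cvnorm (A *m z - b) <= cvnorm (A *m y - b).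

(* Main.v *)
Require Import Defs.
From mathcomp Require Import all_boot all_order all_algebra.
From mathcomp Require Import boolp classical_sets reals.

(** Write S for the column space of A2. The projector P onto the orthogonal
    complement of S annihilates S ([orthogonal_projector_kernel]), so
    b = A1 x1 + A2 x2 projects to P b = P A1 x1: the projected system is
    consistent, with x1 as a solution and least residual 0. Its least squares
    solutions are therefore exactly its solutions
    ([least_squares_solution_consistent]), and uniqueness is the injectivity
    of P A1.

    For injectivity, suppose P A1 d = 0. Then A1 d is orthogonal to the
    complement of S. The first k rows of the inverse of A form a left inverse
    U of A1 with U A2 = 0 ([row_mx_unit_left_inverse]); the rows of U thus lie
    in the complement of S, whence d = U A1 d = 0
    ([projected_block_inj]). *)

Import Order.TTheory GRing.Theory Num.Theory.
Local Open Scope ring_scope.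

Lemma cvdotE (R : realType) (n : nat) (u v : 'cV[R]_n) :
  cvdot u v = (u^T *m v) 0 0.
Proof. by rewrite mxE; apply: eq_bigr => i _; rewrite mxE. Qed.

Lemma cvdotC (R : realType) (n : nat) (u v : 'cV[R]_n) :
  cvdot u v = cvdot v u.
Proof. by apply: eq_bigr => i _; rewrite mulrC. Qed.

Lemma cvdotBr (R : realType) (n : nat) (u v w : 'cV[R]_n) :
  cvdot u (v - w) = cvdot u v - cvdot u w.
Proof. by rewrite !cvdotE mulmxBr !mxE. Qed.

Lemma cvdot_ge0 (R : realType) (n : nat) (v : 'cV[R]_n) : 0 <= cvdot v v.
Proof. by apply: sumr_ge0 => i _; rewrite -expr2 sqr_ge0. Qed.

Lemma cvdot_eq0 (R : realType) (n : nat) (v : 'cV[R]_n) :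
  cvdot v v = 0 -> v = 0.
Proof.
move/eqP; rewrite psumr_eq0 => [/allP v0|i _]; last by rewrite -expr2 sqr_ge0.
apply/colP => i; rewrite mxE.
by have /eqP/eqP := v0 i (mem_index_enum i); rewrite mulf_eq0 orbb => /eqP.
Qed.

Lemma cvnorm0 (R : realType) (n : nat) : cvnorm (0 : 'cV[R]_n) = 0.
Proof. by rewrite /cvnorm cvdotE mulmx0 mxE sqrtr0. Qed.

Lemma cvnorm_le0 (R : realType) (n : nat) (v : 'cV[R]_n) :
  cvnorm v <= 0 -> v = 0.
Proof.
rewrite /cvnorm => v0; apply: cvdot_eq0; apply: le_anti.
by rewrite cvdot_ge0 andbT -sqrtr_eq0 eq_le v0 sqrtr_ge0.
Qed.

Lemma least_squares_solution_consistent (R : realType) (n p : nat)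
    (A : 'M[R]_(n, p)) (x z : 'cV[R]_p) :
  least_squares_solution A (A *m x) z <-> A *m z = A *m x.
Proof.
split=> [/(_ x)|Azx y]; last by rewrite Azx subrr cvnorm0 sqrtr_ge0.
by rewrite subrr cvnorm0 => /cvnorm_le0/eqP; rewrite subr_eq0 => /eqP.
Qed.

(** For u in S, both terms of |Pu|^2 = <Pu, u> - <Pu, u - Pu> vanish: Pu is
    in the complement of S, and u - Pu is orthogonal to that complement. *)
Lemma orthogonal_projector_kernel (R : realType) (n : nat)
    (S : set 'cV[R]_n) (P : 'M[R]_n) (u : 'cV[R]_n) :
  orthogonal_projector (orthocompl S) P -> S u -> P *m u = 0.
Proof.
move=> hP Su; have [SPu PuK] := hP u.
apply: cvdot_eq0; have := PuK _ SPu.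
by rewrite cvdotBr cvdotC (SPu _ Su) sub0r => /eqP; rewrite oppr_eq0 => /eqP.
Qed.

Lemma row_mx_unit_left_inverse (R : realType) (k m : nat)
    (A1 : 'M[R]_(k + m, k)) (A2 : 'M[R]_(k + m, m)) :
  row_mx A1 A2 \in unitmx ->
  exists U : 'M[R]_(k, k + m), U *m A1 = 1%:M /\ U *m A2 = 0.
Proof.
move=> Aunit; exists (usubmx (invmx (row_mx A1 A2))).
have := congr1 usubmx (mulVmx Aunit).
rewrite -mul_usub_mx mul_mx_row scalar_mx_block block_mxEv col_mxKu.
by case/eq_row_mx.
Qed.

Lemma orthocompl_colspace_row (R : realType) (n p q : nat)
    (U : 'M[R]_(q, n)) (B : 'M[R]_(n, p)) (i : 'I_q) :
  U *m B = 0 -> orthocompl (colspace B) (row i U)^T.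
Proof.
move=> UB0 _ [w _ <-].
by rewrite cvdotC cvdotE trmxK mulmxA -row_mul UB0 row0 mul0mx mxE.
Qed.

(** When P kills A1 d, this vector equals its own residual A1 d - P A1 d and
    is orthogonal to the complement of the range of A2. The rows of U lie in
    that complement, and the entries of d = U A1 d are their inner products
    with A1 d. *)
Lemma projected_block_inj (R : realType) (n k m : nat)
    (A1 : 'M[R]_(n, k)) (A2 : 'M[R]_(n, m)) (U : 'M[R]_(k, n)) (P : 'M[R]_n)
    (d : 'cV[R]_k) :
  orthogonal_projector (orthocompl (colspace A2)) P ->
  U *m A1 = 1%:M -> U *m A2 = 0 -> P *m A1 *m d = 0 -> d = 0.
Proof.
move=> hP UA1 UA2 PA1d0; have [_] := hP (A1 *m d).
rewrite mulmxA PA1d0 subr0 => A1dK.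
apply/colP => i; have := A1dK _ (orthocompl_colspace_row _ _ _ _ _ _ i UA2).
by rewrite cvdotE trmxK -row_mul mulmxA UA1 mul1mx !mxE.
Qed.

(* n = k + m, so that m = n - k *)
Theorem theorem2p1 (R : realType) (k m : nat) (hk : (1 <= k)%N)
    (hkn : (k < k + m)%N)
    (A : 'M[R]_(k + m)) (A1 : 'M[R]_(k + m, k)) (A2 : 'M[R]_(k + m, m))
    (hA : A = row_mx A1 A2) (hAinv : A \in unitmx)
    (P : 'M[R]_(k + m))
    (hP : orthogonal_projector (orthocompl (colspace A2)) P)
    (b : 'cV[R]_(k + m))
    (x : 'cV[R]_(k + m)) (x1 : 'cV[R]_k) (x2 : 'cV[R]_m)
    (hx : x = col_mx x1 x2) (hAx : A *m x = b) :
  forall z : 'cV[R]_k,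
    least_squares_solution (P *m A1) (P *m b) z <-> z = x1.
Proof.
move=> z; rewrite hA in hAinv.
have [U [UA1 UA2]] := row_mx_unit_left_inverse _ _ _ _ _ hAinv.
have PA2 : P *m (A2 *m x2) = 0.
  by apply: orthogonal_projector_kernel hP _; exists x2.
have -> : P *m b = P *m A1 *m x1.
  by rewrite -hAx hA hx mul_row_col mulmxDr PA2 addr0 mulmxA.
rewrite least_squares_solution_consistent; split=> [eqzx|->//].
apply/eqP; rewrite -subr_eq0; apply/eqP.
by apply: (projected_block_inj _ _ _ _ _ _ _ _ _ hP UA1 UA2);
  rewrite mulmxBr eqzx subrr.
Qed.
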